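(* Let $G=(V,E)$ be an undirected $d$-regular graph of diameter $2$ with $n=\alpha\cdot d^2$ vertices. Then $$h_e(G)\ge\frac{2d+1-\sqrt{4(1-\alpha)d^2+4d+1}}{4}.$$
   Context: Graphs are finite and simple; the diameter is the maximum distance between two vertices. The edge expansion is $h_e(G):=\min_{0<|S|\le n/2}\frac{|e(S,S^c)|}{|S|}$, where $S$ ranges over subsets of $V$, $S^c=V\setminus S$, and $e(S,S^c)$ is the set of edges with one endpoint in $S$ and the other in $S^c$. *)

(* Defs.v *)
From mathcomp Require Import all_boot all_order all_algebra.

Set Implicit Arguments.
Unset Strict Implicit.
Unset Printing Implicit Defensive.

Import Order.TTheory GRing.Theory Num.Theory.
Local Open Scope ring_scope.

(* A finite simple graph is a symmetric irreflexive relation e on a finType T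
   of vertices. *)
Definition simple_graph (T : finType) (e : rel T) : Prop :=
  symmetric e /\ irreflexive e.

Definition regular (T : finType) (e : rel T) (d : nat) : Prop :=
  forall u : T, #|[set v | e u v]| = d.

(* In [path e u p] the tail p excludes u, so its size is the number of edges.
   The value is #|T| when v is not reachable from u, see distP below. *)
Definition dist (T : finType) (e : rel T) (u v : T) : nat :=
  find (fun k : nat => [exists p : k.-tuple T, path e u p && (last u p == v)])
       (iota 0 #|T|).

(* A disconnected graph has infinite diameter, hence the first conjunct. *)
Definition has_diameter (T : finType) (e : rel T) (k : nat) : Prop :=
  (forall u v : T, connect e u v) /\
  (\max_(u : T) \max_(v : T) dist e u v)%N = k.

(* e(S, S^c), with an edge represented by the set of its two endpoints. *)
Definition cut_edges (T : finType) (e : rel T) (S : {set T}) : {set {set T}} :=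
  [set [set u; v] | u in S, v in ~: S & e u v].

Definition cut_ratio (R : rcfType) (T : finType) (e : rel T) (S : {set T}) : R :=
  #|cut_edges e S|%:R / #|S|%:R.

Definition admissible (T : finType) (S : {set T}) : bool :=
  (0 < #|S|)%N && (#|S|.*2 <= #|T|)%N.

(* The minimum of cut_ratio over admissible sets. The value 0 is taken only on
   graphs with at most one vertex, where no set is admissible. *)
Definition edge_expansion (R : rcfType) (T : finType) (e : rel T) : R :=
  if [pick S : {set T} | admissible S] is Some S0 then
    cut_ratio R e [arg min_(S < S0 | admissible S) cut_ratio R e S]%O
  else 0.

Lemma distP (T : finType) (e : rel T) (u v : T) :
  connect e u v ->
  (exists p : seq T, [/\ path e u p, last u p = v & size p = dist e u v]) /\
  (forall p : seq T, path e u p -> last u p = v -> (dist e u v <= size p)%N).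
Proof.
move=> /connectP [p0 p0P p0v]; rewrite /dist; set a := (fun k : nat => _).
have aP (p : seq T) : path e u p -> last u p = v -> a (size p).
  move=> pP pv; apply/existsP; exists (in_tuple p) => /=.
  by rewrite pP pv eqxx.
have minP (p : seq T) :
    path e u p -> last u p = v -> (find a (iota 0 #|T|) <= size p)%N.
  move=> pP pv; rewrite leqNgt; apply/negP => lt_p.
  have := before_find 0 lt_p.
  by rewrite nth_iota ?add0n ?aP // -[X in (_ < X)%N](size_iota 0)
             (leq_trans lt_p) // find_size.
split=> //.
have has_a : has a (iota 0 #|T|).
  move: p0v; case: (shortenP p0P) => q qP q_uniq _ qv.
  apply/hasP; exists (size q); last exact: aP.
  by rewrite mem_iota add0n /=; have /card_uniqP /= <- := q_uniq; exact: max_card.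
have lt_f : (find a (iota 0 #|T|) < #|T|)%N.
  by rewrite -[X in (_ < X)%N](size_iota 0) -has_find.
have := nth_find 0 has_a; rewrite nth_iota // add0n => /existsP [p /andP[pP /eqP pv]].
by exists p; split=> //; rewrite size_tuple.
Qed.

Lemma edge_expansionP (R : rcfType) (T : finType) (e : rel T) :
  (1 < #|T|)%N ->
  (exists2 S : {set T}, admissible S & edge_expansion R e = cut_ratio R e S) /\
  (forall S : {set T}, admissible S -> edge_expansion R e <= cut_ratio R e S).
Proof.
move=> T_gt1; rewrite /edge_expansion; case: pickP => [S0 adm0 | no_adm].
  by case: arg_minP => // S adm minS; split; [exists S | exact: minS].
have /card_gt0P [x _] := ltnW T_gt1.
by have := no_adm [set x]; rewrite /admissible cards1 T_gt1.
Qed.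

(* Main.v *)
Require Import Defs.
From mathcomp Require Import all_boot all_order all_algebra.
From mathcomp Require Import zify ring lra.

Set Implicit Arguments.
Unset Strict Implicit.
Unset Printing Implicit Defensive.

Import Order.TTheory GRing.Theory Num.Theory.
Local Open Scope ring_scope.

(* Let S be admissible with a = |S|, b = n - a and c cut edges, and let x w be
   the number of neighbours of w on the other side of the cut. Every pair in
   S * S^c is joined by an edge or by a path of length two, and (d - x w) x w
   such paths have w as their middle vertex. Hence
   a b <= c + \sum_w (d - x w) x w. The sum of x over S and its sum over S^c
   are both c, so Cauchy-Schwarz on each side gives
   a b + c^2 / a + c^2 / b <= (2 d + 1) c. For k = n c / (a b) this reads
   k^2 - (2 d + 1) k + n <= 0, so k is at least the smaller root, and
   c / a = k b / n >= k / 2 because b >= n / 2. *)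

(** A sum of booleans rather than a cardinality, so that exchange of summation and distributivity
    apply directly. *)
Definition degree_in (T : finType) (e : rel T) (A : {set T}) (w : T) : nat :=
  \sum_(v in A) e w v.

Lemma degree_inE (T : finType) (e : rel T) (A : {set T}) (w : T) :
  degree_in e A w = #|[set v in A | e w v]|.
Proof.
rewrite /degree_in -sum1dep_card big_mkcondr /=.
by apply: eq_bigr => v _; case: (e w v).
Qed.

Lemma degree_inC (T : finType) (e : rel T) (A : {set T}) (d : nat) (w : T) :
  regular e d -> (degree_in e A w + degree_in e (~: A) w)%N = d.
Proof.
move=> /(_ w) <-; rewrite !degree_inE -(cardsID A [set v | e w v]).
by congr (_ + _)%N; apply: eq_card => v; rewrite !inE // andbC.
Qed.

Lemma sum_degree_in_sym (T : finType) (e : rel T) (A B : {set T}) :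
  symmetric e ->
  (\sum_(u in A) degree_in e B u = \sum_(v in B) degree_in e A v)%N.
Proof.
move=> e_sym; rewrite exchange_big /=.
by do 2![apply: eq_bigr => ? _]; rewrite e_sym.
Qed.

(** Exactly one endpoint of a cut edge lies in [S], so the unordered pair determines the ordered
    one. *)
Lemma card_cut_edges (T : finType) (e : rel T) (S : {set T}) :
  #|cut_edges e S| = (\sum_(u in S) degree_in e (~: S) u)%N.
Proof.
rewrite /cut_edges /degree_in pair_big /=.
pose D := [set p : T * T | (p.1 \in S) && (p.2 \in ~: S) && e p.1 p.2].
have -> : [set [set u; v] | u in S, v in ~: S & e u v]
          = [set [set p.1; p.2] | p in D].
  apply/setP => X; apply/imset2P/imsetP.
    case=> u v uS; rewrite inE => /andP[vS euv] ->.
    by exists (u, v); rewrite // inE /= uS vS.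
  case=> -[u v]; rewrite inE /= => /andP[/andP[uS vS] euv] ->.
  by exists u v; rewrite // inE /= vS.
rewrite card_in_imset => [|[u v] [u' v']].
  rewrite -sum1dep_card big_mkcondr /=.
  by apply: eq_bigr => p _; case: (e _ _).
rewrite !inE /= => /andP[/andP[uS vS] _] /andP[/andP[u'S v'S] _] eqX.
have := set21 u v; have := set22 u v; rewrite eqX !inE.
move=> /orP[/eqP v_eq | /eqP ->]; first by rewrite v_eq u'S in vS.
by move=> /orP[/eqP -> // | /eqP u_eq]; rewrite u_eq (negPf v'S) in uS.
Qed.

Lemma diameter2_path (T : finType) (e : rel T) (u v : T) :
  has_diameter e 2 -> u != v -> ~~ e u v -> exists2 w, e u w & e w v.
Proof.
move=> [conn diam] neq_uv nadj; have [[p [pP pv szp]] _] := distP (conn u v).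
have : (size p <= 2)%N.
  rewrite szp -diam.
  apply: leq_trans (leq_bigmax (F := fun u => (\max_v dist e u v)%N) u).
  exact: (leq_bigmax (F := dist e u) v).
case: p pP pv {szp} => [_ /= uv | w [|w' [|//]]] /=.
- by rewrite uv eqxx in neq_uv.
- by rewrite andbT => euw wv; rewrite -wv euw in nadj.
- by rewrite andbT => /andP[euw eww'] <- _; exists w.
Qed.

(** [dist] is a [find] in a list of length [#|T|], so a single vertex would force diameter at most
    1. This makes admissible sets available. *)
Lemma diameter2_card_gt1 (T : finType) (e : rel T) :
  has_diameter e 2 -> (1 < #|T|)%N.
Proof.
move=> [_ diam].
rewrite ltnNge; apply/negP => T_le1.
have : (\max_(u : T) \max_(v : T) dist e u v <= 1)%N.
  apply/bigmax_leqP => u _; apply/bigmax_leqP => v _.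
  apply: leq_trans T_le1; rewrite -[X in (_ <= X)%N](size_iota 0).
  exact: find_size.
by rewrite diam.
Qed.

Lemma diameter2_count (T : finType) (e : rel T) (S : {set T}) :
  symmetric e -> has_diameter e 2 ->
  (#|S| * #|~: S| <= \sum_(u in S) degree_in e (~: S) u
     + \sum_w degree_in e S w * degree_in e (~: S) w)%N.
Proof.
move=> e_sym diam.
(* Walks [u], [w], [v] from [S] to its complement, grouped by endpoints instead of by middle
   vertex. *)
have -> : (\sum_w degree_in e S w * degree_in e (~: S) w
           = \sum_(u in S) \sum_(v in ~: S) \sum_w e u w * e w v)%N.
  under [RHS]eq_bigr => u _ do rewrite exchange_big /=.
  rewrite [RHS]exchange_big /=; apply: eq_bigr => w _.
  rewrite /degree_in big_distrl /=; apply: eq_bigr => u _.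
  by rewrite big_distrr; apply: eq_bigr => v _; rewrite e_sym.
rewrite -big_split /= -sum_nat_const; apply: leq_sum => u uS.
rewrite -big_split /= -sum1_card; apply: leq_sum => v vS.
have [//|nadj] := boolP (e u v).
have neq_uv : u != v by apply: contraTneq vS => <-; rewrite inE uS.
have [w euw ewv] := diameter2_path diam neq_uv nadj.
by rewrite (bigD1 w) //= euw ewv.
Qed.

Lemma diameter2_cut (T : finType) (e : rel T) (d : nat) (S : {set T}) :
  symmetric e -> regular e d -> has_diameter e 2 ->
  (#|S| * #|~: S| + \sum_(w in S) degree_in e (~: S) w ^ 2
     + \sum_(w in ~: S) degree_in e S w ^ 2
   <= (2 * d + 1) * #|cut_edges e S|)%N.
Proof.
move=> e_sym reg diam; have := diameter2_count S e_sym diam.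
rewrite -card_cut_edges (bigID (mem S)) /=.
under [X in (_ + (_ + X))%N]eq_bigl => w do rewrite -in_setC.
set c := #|cut_edges e S|; set P := (\sum_(w in S) _ * _)%N.
set Q := (\sum_(w in ~: S) _ * _)%N.
(* The identity (d - x) x + x^2 = d x is summed in this form to avoid truncated subtraction. *)
have sumP : (P + \sum_(w in S) degree_in e (~: S) w ^ 2 = d * c)%N.
  rewrite /P -big_split /c card_cut_edges big_distrr /=.
  by apply: eq_bigr => w _; rewrite -(degree_inC S w reg) mulnDl -mulnn.
have sumQ : (Q + \sum_(w in ~: S) degree_in e S w ^ 2 = d * c)%N.
  rewrite /Q -big_split /c card_cut_edges sum_degree_in_sym // big_distrr /=.
  apply: eq_bigr => w _.
  by rewrite -(degree_inC S w reg) mulnDl -mulnn addnC [X in (_ + X)%N]mulnC.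
by move=> le_ab; rewrite mulnDl mul1n -mulnA -sumP; lia.
Qed.

(** Summing 2 F(i) F(j) <= F(i)^2 + F(j)^2 over all pairs in [A] gives twice the claim. *)
Lemma sum_sqr_Cauchy (I : finType) (A : {set I}) (F : I -> nat) :
  ((\sum_(i in A) F i) ^ 2 <= #|A| * \sum_(i in A) F i ^ 2)%N.
Proof.
rewrite -(leq_pmul2l (isT : 0 < 2)%N) -mulnn big_distrlr /=.
apply: (@leq_trans (\sum_(i in A) \sum_(j in A) (F i ^ 2 + F j ^ 2))%N).
  rewrite big_distrr; apply: leq_sum => i _.
  by rewrite big_distrr; apply: leq_sum => j _; exact: nat_Cauchy.
under eq_bigr => i _ do rewrite big_split sum_nat_const /=.
by rewrite big_split sum_nat_const -big_distrr /= mul2n addnn.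
Qed.

Lemma ratio_ge_root (R : rcfType) (d a b c X Y : R) :
  0 < a -> a <= b -> 0 <= c ->
  a * b + X + Y <= (2 * d + 1) * c -> c ^+ 2 <= a * X -> c ^+ 2 <= b * Y ->
  (2 * d + 1 - Num.sqrt ((2 * d + 1) ^+ 2 - 4 * (a + b))) / 4 <= c / a.
Proof.
move=> a_gt0 le_ab c_ge0 cut leX leY.
have b_gt0 : 0 < b by exact: lt_le_trans le_ab.
(* This is c / a + c / b, the sum of the cut ratios seen from the two sides. *)
pose k := (a + b) * c / (a * b).
have le_root : k ^+ 2 - (2 * d + 1) * k + (a + b) <= 0.
  have -> : k ^+ 2 - (2 * d + 1) * k + (a + b)
      = (a + b) / (a * b)
        * (c ^+ 2 / a + c ^+ 2 / b - (2 * d + 1) * c + a * b).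
    by rewrite /k; field; rewrite !gt_eqF.
  rewrite pmulr_rle0 ?divr_gt0 ?addr_gt0 ?mulr_gt0 //.
  have : c ^+ 2 / a <= X by rewrite ler_pdivrMr // mulrC.
  have : c ^+ 2 / b <= Y by rewrite ler_pdivrMr // mulrC.
  lra.
(* Completing the square in four times [le_root]; the root then bounds the absolute value of 2 k -
   (2 d + 1), and only the lower bound on k is kept. *)
have : (2 * k - (2 * d + 1)) ^+ 2 <= (2 * d + 1) ^+ 2 - 4 * (a + b) by lra.
move=> /ler_wsqrtr; rewrite sqrtr_sqr ler_norml => /andP[k_ge _].
have : k <= 2 * (c / a).
  have -> : k = (1 + a / b) * (c / a) by rewrite /k; field; rewrite !gt_eqF.
  apply: ler_wpM2r; first by rewrite divr_ge0 // ltW.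
  have : a / b <= 1 by rewrite ler_pdivrMr // mul1r.
  lra.
lra.
Qed.

Theorem theorem4p5 (R : rcfType) (T : finType) (e : rel T) (d : nat) (alpha : R) :
  simple_graph e ->
  regular e d ->
  has_diameter e 2 ->
  #|T|%:R = alpha * d%:R ^+ 2 ->
  (2 * d%:R + 1 - Num.sqrt (4 * (1 - alpha) * d%:R ^+ 2 + 4 * d%:R + 1)) / 4
    <= edge_expansion R e.
Proof.
move=> [e_sym _] reg diam cardT.
(* The minimum is attained, so it suffices to bound the ratio of one admissible [S]. *)
have [[S /andP[S_gt0 S_le] ->] _] :=
  edge_expansionP R e (diameter2_card_gt1 diam).
have cardS : (#|S| + #|~: S| = #|T|)%N by rewrite cardsC.
(* The radicand is the discriminant (2 d + 1)^2 - 4 n with n = alpha d^2. *)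
have -> : 4 * (1 - alpha) * d%:R ^+ 2 + 4 * d%:R + 1
          = (2 * d%:R + 1) ^+ 2 - 4 * (#|S|%:R + #|~: S|%:R) :> R.
  by rewrite -natrD cardS cardT; ring.
apply: (@ratio_ge_root _ _ _ #|~: S|%:R _
  (\sum_(w in S) degree_in e (~: S) w ^ 2)%:R
  (\sum_(w in ~: S) degree_in e S w ^ 2)%:R).
- by rewrite ltr0n.
- by rewrite ler_nat; lia.
- exact: ler0n.
- by have := diameter2_cut S e_sym reg diam;
     rewrite -(ler_nat R) !(natrD, natrM) => /le_trans ->.
- by rewrite -natrX -natrM ler_nat card_cut_edges sum_sqr_Cauchy.
- by rewrite -natrX -natrM ler_nat card_cut_edges sum_degree_in_sym //
             sum_sqr_Cauchy.
Qed.
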